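(* Let $k\ge1$, $0\le l\le k$, $N\ge1$ be integers. The map $\iota_{k,l}^N:\mathcal P_{k,l}^N\to\mathcal C_{k,l}^{(N)}$, $(\boldsymbol\alpha;\boldsymbol\beta)\mapsto(\mathbf a;\mathbf b)$, given by $$a_{i-1}=y(\alpha_i,\beta_i,\alpha_{i+1})\quad(i=1,\dots,N),$$ $$b_i=z(\alpha_i,\beta_i,\alpha_{i+1})-\bigl(y(\alpha_{i+1},\beta_{i+1},\alpha_{i+2})-x(\alpha_i,\beta_i,\alpha_{i+1})\bigr)^+\quad(i=1,\dots,N-1),$$ is well-defined and bijective.
   Context: $t^+=\max(t,0)$, and $x(\alpha,\beta,\gamma)=\frac{\alpha+\gamma-\beta}2$, $y(\alpha,\beta,\gamma)=\frac{\alpha+\beta-\gamma}2$, $z(\alpha,\beta,\gamma)=\frac{\beta+\gamma-\alpha}2$. A triple $(\alpha,\beta,\gamma)\in\{0,\dots,k\}^3$ is an admissible Verlinde triple of level $k$ if $x,y,z$ evaluated on it are non-negative integers with $x+y+z\le k$ (equivalently $\alpha=x+y$, $\beta=y+z$, $\gamma=x+z$ for some $x,y,z\in\mathbb Z_{\ge0}$ with $x+y+z\le k$). $\mathcal P_{k,l}^N$ (Verlinde paths of length $N$, level $k$, weight $l$) is the set of $(\boldsymbol\alpha;\boldsymbol\beta)=(\alpha_1,\dots,\alpha_N;\beta_1,\dots,\beta_{N-1})\in\{0,\dots,k\}^{2N-1}$ with $\alpha_1=l$ and $(\alpha_i,\beta_i,\alpha_{i+1})$ admissible for $i=1,\dots,N-1$.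 One sets $\beta_N=\alpha_N$ and $\alpha_i=\beta_i=0$ for $i>N$ (except that $\beta_N=\alpha_N$). $\mathcal C_{k,l}^{(N)}$ (combinatorial paths of length $N$, level $k$, weight $l$) is the set of all $(\mathbf a;\mathbf b)=(a_{N-1},\dots,a_0;b_{N-1},\dots,b_1)\in\{0,\dots,k\}^{2N-1}$ such that (1) $a_0\le l$; (2) $a_i+b_{i+1}+a_{i+1}\le k$ and $b_i+a_i+b_{i+1}\le k$ for all integers $i\ge0$; (3) $\sum_{s=i}^jb_s\le k+\sum_{s=i+1}^{j-2}a_s$ for all $-1\le i<j\le\infty$. Here $b_\infty=k$, $b_{-1}=l$, $b_0=a_{-1}=a_\infty=0$, and $a_i=b_i=0$ for $N\le i<\infty$; for $j=\infty$ the left sum includes the term $b_\infty=k$ and the right sum is over all $s\ge i+1$; empty sums are $0$. *)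

(* Defs.v *)
(* Built on MathComp, with the sets and [set_bij] of mathcomp.classical. *)
From mathcomp Require Import all_boot all_order all_algebra.
From mathcomp Require Import classical_sets functions.

Set Implicit Arguments.
Unset Strict Implicit.
Unset Printing Implicit Defensive.

Import Order.TTheory GRing.Theory Num.Theory.
Local Open Scope classical_set_scope.
Local Open Scope ring_scope.

Definition xv (al be ga : rat) : rat := (al + ga - be) / 2.
Definition yv (al be ga : rat) : rat := (al + be - ga) / 2.
Definition zv (al be ga : rat) : rat := (be + ga - al) / 2.

Definition pos_part (t : rat) : rat := Num.max t 0.

(* q is one of the integers 0, ..., k. *)
Definition in_range (k : nat) (q : rat) : Prop := q \is a Num.nat /\ q <= k%:R.

Definition admissible (k : nat) (al be ga : rat) : Prop :=
  [/\ in_range k al, in_range k be & in_range k ga] /\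
  [/\ xv al be ga \is a Num.nat, yv al be ga \is a Num.nat,
      zv al be ga \is a Num.nat
    & xv al be ga + yv al be ga + zv al be ga <= k%:R].

(* Both kinds of paths are sets of (2N-1)-tuples of rationals with entries in
   {0, ..., k}; the ambient rationals make x, y, z meaningful before their
   integrality is known. *)
Definition path_seqs (N : nat) : Type := (N.-tuple rat * N.-1.-tuple rat)%type.

(* alpha_i and beta_i, meant for i >= 1: alpha_i is the entry of index i - 1
   of the first tuple, beta_i (for i < N) that of the second one.  Since the
   default of nth is 0, both vanish for i > N. *)
Definition alpha N (p : path_seqs N) (i : nat) : rat := (p.1)`_i.-1.
Definition beta N (p : path_seqs N) (i : nat) : rat :=
  if i == N then alpha p N else (p.2)`_i.-1.

Definition verlinde_paths (k l N : nat) : set (path_seqs N) :=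
  [set p | [/\ (forall q, q \in p.1 -> in_range k q),
               (forall q, q \in p.2 -> in_range k q),
               alpha p 1 = l%:R
             & forall i : nat, (1 <= i < N)%N ->
                 admissible k (alpha p i) (beta p i) (alpha p i.+1)]].
Arguments verlinde_paths : clear implicits.

(* a_i and b_i for finite indices i >= -1 (the only use of Negz is for -1).
   The tuples are stored by increasing index, (a_0, ..., a_(N-1)) and
   (b_1, ..., b_(N-1)). *)
Definition a_ N (c : path_seqs N) (i : int) : rat :=
  match i with
  | Posz n => (c.1)`_n
  | Negz _ => 0
  end.
Definition b_ (l N : nat) (c : path_seqs N) (i : int) : rat :=
  match i with
  | Posz n.+1 => (c.2)`_n
  | Posz 0 => 0
  | Negz _ => l%:R
  end.

(* \sum_(m <= s <= n) F s over the integers s; it is 0 if n < m. *)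
Definition isum (F : int -> rat) (m n : int) : rat :=
  if m <= n then \sum_(0 <= t < `|n - m|%N.+1) F (m + t%:Z) else 0.

(* The last clause is the case j = oo of the one before it: as a_s = b_s = 0
   for N <= s < oo, b_oo = k and a_oo = 0, the sums over s >= i stop at N - 1
   and the left one has the extra term k. *)
Definition comb_paths (k l N : nat) : set (path_seqs N) :=
  [set c | [/\ (forall q, q \in c.1 -> in_range k q),
               (forall q, q \in c.2 -> in_range k q)
             & let a := a_ c in let b := b_ l c in
               [/\ a 0 <= l%:R,
                   (forall i : int, 0 <= i ->
                      a i + b (i + 1) + a (i + 1) <= k%:R /\
                      b i + a i + b (i + 1) <= k%:R),
                   (forall i j : int, - 1 <= i -> i < j ->
                      isum b i j <= k%:R + isum a (i + 1) (j - 2))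
                 & (forall i : int, - 1 <= i ->
                      isum b i (N%:Z - 1) + k%:R
                        <= k%:R + isum a (i + 1) (N%:Z - 1))]]].
Arguments comb_paths : clear implicits.

Definition x_at N (p : path_seqs N) (i : nat) : rat :=
  xv (alpha p i) (beta p i) (alpha p i.+1).
Definition y_at N (p : path_seqs N) (i : nat) : rat :=
  yv (alpha p i) (beta p i) (alpha p i.+1).
Definition z_at N (p : path_seqs N) (i : nat) : rat :=
  zv (alpha p i) (beta p i) (alpha p i.+1).

(* The entry of index i is a_i = a_((i+1)-1) in the first tuple and b_(i+1)
   in the second one. *)
Definition iota_path N (p : path_seqs N) : path_seqs N :=
  ([tuple y_at p i.+1 | i < N],
   [tuple z_at p i.+1 - pos_part (y_at p i.+2 - x_at p i.+1) | i < N.-1]).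
Arguments iota_path : clear implicits.

(* Main.v *)
Require Import Defs.
From mathcomp Require Import all_boot all_order all_algebra.
From mathcomp Require Import classical_sets functions.
From mathcomp Require Import lra zify.

Set Implicit Arguments.
Unset Strict Implicit.
Unset Printing Implicit Defensive.

Import Order.TTheory GRing.Theory Num.Theory.
Local Open Scope ring_scope.

(** Put [x_i, y_i, z_i] for the values of [x, y, z] on the triple
    [(alpha_i, beta_i, alpha_(i + 1))] of a Verlinde path.  Then
    [alpha_(i + 1) = x_i + z_i = x_(i + 1) + y_(i + 1)], and this makes
    [b_i = z_i - (y_(i + 1) - x_i)^+] the minimum of [z_i] and [x_(i + 1)] and
    gives
      [x_(i + 1) = b_i + (x_i - a_i)^+],   [z_i = b_i + (a_i - x_i)^+],
    starting from [x_1 = l - a_0].  So the [x_i] are the lengths of a queue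
    with arrivals [b] and services [a] ([level], [level_iota]), and the image
    of the path determines the path ([iota_inj]).

    Conversely, run the queue on arbitrary [(a; b)] and define a path by the
    formulas above ([unwind]).  It is a Verlinde path with image [(a; b)] as
    soon as the entries are natural numbers, [a_0 <= l], the queue is empty
    at time [N] (that is, [x_N = 0]) and [x_i + y_i + z_i <= k].  Because
    [z_i] contains a positive part, the last condition is the conjunction of
      [a_i + a_(i - 1) + b_i <= k]   and   [x_i + a_(i - 1) + b_i <= k].
    These conditions define the combinatorial paths ([comb_pathsP]): solving
    the queue recursion expresses [x_i] as a maximum of partial sums of [b]
    minus partial sums of [a] ([level_le]), so that an upper bound on a queue
    length is a family of inequalities between such sums.  The sum inequality
    of a combinatorial path for [j = oo] says that the queue ends empty, and
    those for finite [j], together with [b_i + a_i + b_(i + 1) <= k], give the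
    second inequality. *)

(** * Positive parts and integer-indexed sums *)

Lemma pos_part_ge0 t : 0 <= pos_part t.
Proof. by rewrite /pos_part le_max lexx orbT. Qed.

Lemma pos_part_ge t : t <= pos_part t.
Proof. by rewrite /pos_part le_max lexx. Qed.

Lemma pos_part_le t u : (pos_part t <= u) = (t <= u) && (0 <= u).
Proof. by rewrite /pos_part ge_max. Qed.

Lemma pos_part_id t : 0 <= t -> pos_part t = t.
Proof. by move=> t0; rewrite /pos_part max_l. Qed.

Lemma pos_part_subN t u : pos_part (t - u) - pos_part (u - t) = t - u.
Proof.
by rewrite /pos_part; case: (leP (t - u) 0); case: (leP (u - t) 0); lra.
Qed.

Lemma pos_part_natB t u :
  t \is a Num.nat -> u \is a Num.nat -> pos_part (t - u) \is a Num.nat.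
Proof.
move=> tn un; rewrite natrEint pos_part_ge0 andbT /pos_part.
case: leP => _; rewrite ?rpred0 // rpredB //.
  by move: tn; rewrite natrEint => /andP[].
by move: un; rewrite natrEint => /andP[].
Qed.

Lemma isum_nil F (m n : int) : n < m -> isum F m n = 0.
Proof. by rewrite /isum ltNge => /negbTE ->. Qed.

Lemma isum_recr F (m n : int) : m <= n -> isum F m n = isum F m (n - 1) + F n.
Proof.
move=> le_mn; rewrite {1}/isum le_mn big_nat_recr //=.
rewrite gez0_abs ?subr_ge0 // addrCA subrr addr0; congr (_ + _).
case: (leP m (n - 1)) => [le_mn1|?]; last first.
  by rewrite isum_nil // (_ : `|n - m|%N = 0%N) ?big_nil //; lia.
by rewrite /isum le_mn1; congr (\sum_(0 <= t < _) _); lia.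
Qed.

(** * The queue recursion and combinatorial paths *)

(** The queue-length recursion with arrivals [b] and services [a], started from
    [b (- 1)].  The shift of one step is chosen so that, with [b_(- 1) = l]
    and [b_0 = 0], the value at [i >= 1] is the [x_i] of a path, and
    [x_1 = l - a_0] is itself an instance of the recursion. *)
Fixpoint level (a b : int -> rat) (n : nat) : rat :=
  if n is m.+1 then b m%:Z + pos_part (level a b m - a m%:Z) else b (- 1).

Lemma levelS a b (n : nat) :
  level a b n.+1 = b n%:Z + pos_part (level a b n - a n%:Z).
Proof. by []. Qed.

(** Unfolding the positive parts shows that the queue length is the maximum,
    over a starting time [i], of the arrivals [b_i + ... + b_(n - 1)] minus
    the later services [a_(i + 1) + ... + a_(n - 1)].  In this form, with an
    arbitrary upper bound [t], it turns the family of sum inequalities of a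
    combinatorial path with a given [j] into a bound on one queue length. *)
Lemma level_le a b (n : nat) t :
  level a b n <= t <->
  (forall i : int, - 1 <= i -> i < n%:Z ->
     isum b i (n%:Z - 1) <= t + isum a (i + 1) (n%:Z - 1)).
Proof.
elim: n t => [|n IHn] t.
  split=> [/= bt i i1 i0|/(_ (- 1) erefl erefl)] /=.
    have -> : i = - 1 by lia.
    by rewrite isum_recr ?isum_nil //; lra.
  by rewrite isum_recr ?isum_nil //; lra.
have nE : n.+1%:Z - 1 = n%:Z by lia.
rewrite nE /=; split=> [le_t i i1 ltin|le_t].
  rewrite isum_recr; last by lia.
  have [ltni|lein] := leP n%:Z i.
    have -> : i = n%:Z by lia.
    have := pos_part_ge0 (level a b n - a n).
    by rewrite !isum_nil; [lra | lia | lia].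
  rewrite (isum_recr a); last by lia.
  have /IHn/(_ i i1 lein) : level a b n <= t + a n%:Z - b n%:Z; last by lra.
  by have := pos_part_ge (level a b n - a n); lra.
have bt : b n%:Z <= t.
  have := le_t n%:Z; rewrite isum_recr // !isum_nil; [ | lia | lia].
  by rewrite add0r addr0; apply; lia.
have lt : level a b n <= t + a n%:Z - b n%:Z.
  apply/IHn => i i1 ltin.
  have /(le_t i i1) : i < n.+1%:Z by lia.
  by rewrite (@isum_recr b i n%:Z) ?(@isum_recr a _ n%:Z); [lra | lia..].
suff : pos_part (level a b n - a n) <= t - b n%:Z by lra.
by rewrite pos_part_le; apply/andP; split; lra.
Qed.

Lemma level_ge0 a b n :
  0 <= b (- 1) -> (forall m : nat, 0 <= b m%:Z) -> 0 <= level a b n.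
Proof.
case: n => [|n] //= _ b0; have := pos_part_ge0 (level a b n - a n).
by have := b0 n; lra.
Qed.

Lemma in_range_nth k (s : seq rat) n :
  (forall q, q \in s -> in_range k q) -> in_range k s`_n.
Proof.
move=> s_in; have [lt_ns|le_sn] := ltnP n (size s).
  exact/s_in/mem_nth.
by rewrite nth_default //; split; rewrite ?rpred0 ?ler0n.
Qed.

(** The sum inequalities with [j = oo] bound [level N] by [0].  Writing
    [level n.+1] as [b_n] plus a positive part, the bound on
    [level n.+1 + a_n + b_(n + 1)] splits into [b_n + a_n + b_(n + 1) <= k]
    and a bound on [level n], which is the family of sum inequalities with
    [j = n + 1] and [i <= n - 1].  Those left over, with [i = j - 1], follow
    from [b_i + a_i + b_(i + 1) <= k], or from [l <= k] if [j = 0]. *)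
Lemma comb_pathsP k l N (c : path_seqs N) : (l <= k)%N ->
  let a := a_ c in let b := b_ l c in
  comb_paths k l N c <->
  [/\ (forall q, q \in c.1 -> in_range k q),
      (forall q, q \in c.2 -> in_range k q),
      a 0 <= l%:R, level a b N = 0
    & forall n : nat, a n%:Z + b n.+1 + a n.+1 <= k%:R /\
                      level a b n.+1 + a n + b n.+1 <= k%:R].
Proof.
move=> hl a b.
have lk : l%:R <= k%:R :> rat by rewrite ler_nat.
split=> [[ra rb [al c2 c3 coo]]|[ra rb al levN c2]].
  have a0 (n : nat) : 0 <= a n by apply/natr_ge0; case: (in_range_nth n ra).
  have b0 (n : nat) : 0 <= b n.
    by case: n => // n; apply/natr_ge0; case: (in_range_nth n rb).
  split=> [//|//|//| |n].
    apply: le_anti; apply/andP; split.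
      by apply/level_le => i i1 iN; have := coo i i1; rewrite -/a -/b; lra.
    by apply: level_ge0 => //; rewrite ler0n.
  have [] := c2 n%:Z erefl; rewrite -/a -/b -PoszD addn1 => cA cB; split=> //.
  suff : pos_part (level a b n - a n) <= k%:R - b n - b n.+1 - a n.
    by rewrite levelS; lra.
  rewrite pos_part_le; apply/andP; split; last by lra.
  suff : level a b n <= k%:R - b n - b n.+1 by lra.
  apply/level_le => i i1 ltin.
  have := c3 i n.+1 i1; rewrite -/a -/b.
  have -> : n.+1%:Z - 2 = n%:Z - 1 by lia.
  rewrite (@isum_recr b i n.+1%:Z) ?(@isum_recr b i (n.+1%:Z - 1)); [|lia..].
  have -> : n.+1%:Z - 1 = n%:Z by lia.
  have lti : i < n.+1%:Z by lia.
  by move=> /(_ lti); lra.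
have a0 (n : nat) : 0 <= a n by apply/natr_ge0; case: (in_range_nth n ra).
have b0 (n : nat) : 0 <= b n.
  by case: n => // n; apply/natr_ge0; case: (in_range_nth n rb).
have c2b (n : nat) : b n + a n + b n.+1 <= k%:R.
  have [_] := c2 n; rewrite levelS.
  by have := pos_part_ge0 (level a b n - a n); lra.
have c3 (n : nat) : level a b n <= k%:R - b n - b n.+1.
  have [_] := c2 n; rewrite levelS.
  by have := pos_part_ge (level a b n - a n); lra.
split=> //; split=> //; rewrite -/a -/b.
- by case=> // n _; rewrite -PoszD addn1; split; [case: (c2 n) | exact: c2b].
- move=> i [[|n]|m] i1 ltij; last by rewrite NegzE in ltij; lia.
  + have -> : i = - 1 by lia.
    rewrite (@isum_recr b (- 1) 0) ?(@isum_recr b (- 1) (- 1)) ?isum_nil //.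
    by rewrite add0r !addr0.
  have nE : n.+1%:Z - 1 = n%:Z by lia.
  rewrite isum_recr ?nE; last by lia.
  have [lein|ltni] := ltP i n%:Z; last first.
    have -> : i = n%:Z by lia.
    rewrite isum_recr // !isum_nil; [|lia|lia].
    by have := c2b n; have := a0 n; lra.
  rewrite isum_recr; last by lia.
  have -> : n.+1%:Z - 2 = n%:Z - 1 by lia.
  by have /level_le/(_ i i1 lein) := c3 n; lra.
- move=> i i1.
  have [ltiN|leNi] := ltP i N%:Z; last first.
    by rewrite !isum_nil; [lra | lia | lia].
  have /level_le/(_ i i1 ltiN) : level a b N <= 0 by rewrite levN.
  by lra.
Qed.

(** * Verlinde paths and their image *)

Lemma eq_path_seqs N (c d : path_seqs N) :
  (forall n, (n < N)%N -> (c.1)`_n = (d.1)`_n) ->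
  (forall n, (n < N.-1)%N -> (c.2)`_n = (d.2)`_n) -> c = d.
Proof.
case: c d => [c1 c2] [d1 d2] /= eq1 eq2; congr (_, _).
  by apply: eq_from_tnth => i; rewrite !(tnth_nth 0) eq1.
by apply: eq_from_tnth => i; rewrite !(tnth_nth 0) eq2.
Qed.

(** Both sides are [alpha_(i + 1)], read off from its two adjacent triples. *)
Lemma xz_vertex N (p : path_seqs N) i :
  x_at p i + z_at p i = x_at p i.+1 + y_at p i.+1.
Proof. by rewrite /x_at /y_at /z_at /xv /yv /zv; lra. Qed.

Lemma nth_fst_default N (p : path_seqs N) n : (N <= n)%N -> (p.1)`_n = 0.
Proof. by move=> leNn; rewrite nth_default ?size_tuple. Qed.

Lemma nth_snd_default N (p : path_seqs N) n : (N <= n.+1)%N -> (p.2)`_n = 0.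
Proof. by move=> leNn; rewrite nth_default ?size_tuple //; lia. Qed.

Lemma beta_default N (p : path_seqs N) n : (N <= n)%N -> beta p n.+1 = 0.
Proof.
by move=> leNn; rewrite /beta gtn_eqF ?ltnS // nth_snd_default // leqW.
Qed.

(** The conventions [beta_N = alpha_N] and [alpha_i = beta_i = 0] for [i > N]
    make the triples of index [i >= N] degenerate, so that the identities
    and bounds below hold at every index. *)
Lemma terminal_edge N (p : path_seqs N) n : (N <= n.+1)%N ->
  [/\ x_at p n.+1 = 0, y_at p n.+1 = (p.1)`_n & z_at p n.+1 = 0].
Proof.
move=> leNn; have alS : alpha p n.+2 = 0 by rewrite /alpha nth_fst_default.
have beE : beta p n.+1 = alpha p n.+1.
  move: leNn; rewrite leq_eqVlt => /predU1P[<-|]; first by rewrite /beta eqxx.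
  by rewrite ltnS => leNn; rewrite beta_default // /alpha nth_fst_default.
rewrite /x_at /y_at /z_at /xv /yv /zv alS beE /alpha /=.
by split; lra.
Qed.

Lemma verlinde_edge k l N (p : path_seqs N) n : verlinde_paths k l N p ->
  [/\ x_at p n.+1 \is a Num.nat, y_at p n.+1 \is a Num.nat,
      z_at p n.+1 \is a Num.nat
    & x_at p n.+1 + y_at p n.+1 + z_at p n.+1 <= k%:R].
Proof.
case=> rp _ _ adm; have [ltnN|leNn] := ltnP n.+1 N.
  by case: (adm n.+1 ltnN).
have [-> -> ->] := terminal_edge p leNn.
have [a_nat a_le] := in_range_nth n rp.
by split; rewrite ?rpred0 // add0r addr0.
Qed.

Lemma nth_mktuple_nat (F : nat -> rat) N n :
  [tuple F i | i < N]`_n = if (n < N)%N then F n else 0.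
Proof.
have [ltnN|leNn] := ltnP n N; first by rewrite (nth_mktuple _ 0 (Ordinal ltnN)).
by rewrite nth_default ?size_tuple.
Qed.

Lemma iota_aE N (p : path_seqs N) (n : nat) : a_ (iota_path N p) n = y_at p n.+1.
Proof.
rewrite /a_; have -> := nth_mktuple_nat (fun i => y_at p i.+1) N n.
case: ltnP => // leNn; have [_ -> _] := terminal_edge p (leqW leNn).
by rewrite nth_fst_default.
Qed.

Lemma iota_bE l N (p : path_seqs N) (n : nat) :
  b_ l (iota_path N p) n.+1 =
  z_at p n.+1 - pos_part (y_at p n.+2 - x_at p n.+1).
Proof.
pose F i := z_at p i.+1 - pos_part (y_at p i.+2 - x_at p i.+1).
rewrite /b_; have -> := nth_mktuple_nat F N.-1 n; rewrite /F.
case: ltnP => // leNn; have leNn1 : (N <= n.+1)%N by lia.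
have [-> _ ->] := terminal_edge p leNn1.
have [_ -> _] := terminal_edge p (leqW leNn1).
by rewrite nth_fst_default // pos_part_id ?subrr.
Qed.

(** With [d = y_(i + 1) - x_i], the formula [b_i = z_i - d^+] and
    [x_(i + 1) = x_i + z_i - y_(i + 1) = z_i - d] give
    [x_(i + 1) = b_i + (- d)^+], since [d^+ - (- d)^+ = d]: this is one step
    of the queue. *)
Lemma level_iota k l N (p : path_seqs N) (n : nat) : verlinde_paths k l N p ->
  let c := iota_path N p in level (a_ c) (b_ l c) n.+1 = x_at p n.+1.
Proof.
move=> pP c; elim: n => [|n IHn].
  have [x0 _ _ _] := verlinde_edge 0 pP.
  have lE : l%:R = x_at p 1 + y_at p 1.
    by case: pP => _ _ <- _; rewrite /x_at /y_at /xv /yv; lra.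
  rewrite levelS iota_aE /= lE add0r addrK.
  by rewrite pos_part_id // natr_ge0.
rewrite levelS IHn iota_aE iota_bE.
have := pos_part_subN (y_at p n.+2) (x_at p n.+1).
by have := xz_vertex p n.+1; lra.
Qed.

Lemma iota_comb k l N (p : path_seqs N) : (l <= k)%N -> (1 <= N)%N ->
  verlinde_paths k l N p -> comb_paths k l N (iota_path N p).
Proof.
move=> lk N1 pP; set c := iota_path N p.
have edge n := verlinde_edge n pP.
have pp n := pos_part_ge (y_at p n.+2 - x_at p n.+1).
have pp0 n := pos_part_ge0 (y_at p n.+2 - x_at p n.+1).
apply/comb_pathsP => //; split.
- move=> q /tnthP[i ->]; rewrite tnth_mktuple.
  have [/natr_ge0 x0 yn /natr_ge0 z0 le_k] := edge i; split=> //; lra.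
- move=> q /tnthP[i ->]; rewrite tnth_mktuple.
  have [xn yn zn le_k] := edge i; have [xn' yn' zn' le_k'] := edge i.+1.
  split; last by have := natr_ge0 xn; have := natr_ge0 yn; have := pp0 i; lra.
  (* The entry is the smaller of z_i and x_(i + 1), hence a natural number. *)
  rewrite /pos_part; case: leP => _; first by rewrite subr0.
  have := xz_vertex p i.+1; set t := z_at _ _ - _ => tE.
  by have -> : t = x_at p i.+2 by rewrite /t; lra.
- rewrite iota_aE; have [/natr_ge0 x0 _ _ _] := edge 0.
  by case: pP => _ _ <- _; move: x0; rewrite /x_at /y_at /xv /yv; lra.
- have := level_iota N.-1 pP.
  by case: (terminal_edge p (leqSpred N)) => -> _ _; rewrite prednK.
- move=> n; rewrite (level_iota n pP) -/c !iota_aE iota_bE.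
  have [/natr_ge0 x0 /natr_ge0 y0 /natr_ge0 z0 le_k] := edge n.
  by have := pp n; have := pp0 n; split; lra.
Qed.

(** The image determines the [x_i], as queue lengths, and the [y_i]; then
    [alpha_i = x_i + y_i] and [beta_i = 2 y_i - alpha_i + alpha_(i + 1)]. *)
Lemma iota_inj k l N :
  {in verlinde_paths k l N &, injective (iota_path N)}.
Proof.
move=> p q; rewrite !in_setE => pP qP eqpq.
have xE n : x_at p n.+1 = x_at q n.+1.
  by rewrite -(level_iota n pP) -(level_iota n qP) eqpq.
have yE n : y_at p n.+1 = y_at q n.+1 by rewrite -!iota_aE eqpq.
have alE n : alpha p n.+1 = alpha q n.+1.
  have := xE n; have := yE n; rewrite /x_at /y_at /xv /yv; lra.
apply: eq_path_seqs => n ltnN; first exact: alE.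
have beE : beta p n.+1 = beta q n.+1.
  by have := yE n; rewrite /y_at /yv alE (alE n.+1); lra.
by move: beE; rewrite /beta ltn_eqF; last lia.
Qed.

(** * The inverse map *)

(** The candidate inverse of [iota_path]: take the queue length for [x_i],
    [y_i = a_(i - 1)] and [z_i = b_i + (a_i - x_i)^+] in
    [alpha_i = x_i + y_i] and [beta_i = y_i + z_i]. *)
Definition unwind l N (c : path_seqs N) : path_seqs N :=
  let x := level (a_ c) (b_ l c) in
  ([tuple x i.+1 + a_ c i | i < N],
   [tuple a_ c i + b_ l c i.+1 + pos_part (a_ c i.+1 - x i.+1) | i < N.-1]).

Section Unwind.

Variables (l N : nat) (c : path_seqs N).
Let a := a_ c.
Let b := b_ l c.
Hypothesis level0 : level a b N = 0.

(** Neither arrivals nor services occur from time [N] on, so a queue that is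
    empty at time [N] stays empty. *)
Lemma level_eq0 n : (N <= n)%N -> level a b n = 0.
Proof.
elim: n => [|n IHn]; first by rewrite leqn0 => /eqP N0; rewrite -level0 N0.
rewrite leq_eqVlt => /predU1P[<- //|]; rewrite ltnS => leNn.
rewrite levelS IHn // /a [a_ _ _]nth_fst_default // pos_part_id ?subrr // addr0.
by rewrite /b; case: n leNn {IHn} => //= n ?; rewrite nth_snd_default.
Qed.

Lemma alpha_unwind n : alpha (unwind l c) n.+1 = level a b n.+1 + a n.
Proof.
rewrite /alpha; have -> := nth_mktuple_nat (fun i : nat => level a b i.+1 + a i) N n.
case: ltnP => // leNn.
by rewrite level_eq0 ?leqW // [a n]nth_fst_default ?addr0.
Qed.

Lemma beta_unwind n :
  beta (unwind l c) n.+1 = a n + b n.+1 + pos_part (a n.+1 - level a b n.+1).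
Proof.
pose F (i : nat) : rat := a i + b i.+1 + pos_part (a i.+1 - level a b i.+1).
have [ltnN|leNn] := ltnP n.+1 N.
  have ltnN1 : (n < N.-1)%N by lia.
  rewrite /beta ltn_eqF //; have -> := nth_mktuple_nat F N.-1 n.
  by rewrite ltnN1.
rewrite level_eq0 // [a n.+1]nth_fst_default //.
rewrite [b _]nth_snd_default // pos_part_id ?subrr // !addr0.
move: leNn; rewrite leq_eqVlt => /predU1P[NE|leNn].
  have -> : beta (unwind l c) n.+1 = alpha (unwind l c) n.+1.
    by rewrite /beta -NE eqxx; congr (alpha _ _).
  by rewrite alpha_unwind level_eq0 -?NE // add0r.
by rewrite beta_default // [a _]nth_fst_default.
Qed.

(** The values of [x] and [z] rely on [x_i + z_i = alpha_(i + 1)], which for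
    the chosen [z_i] is the queue recursion at [i]. *)
Lemma edge_unwind n :
  [/\ x_at (unwind l c) n.+1 = level a b n.+1, y_at (unwind l c) n.+1 = a n
    & z_at (unwind l c) n.+1 = b n.+1 + pos_part (a n.+1 - level a b n.+1)].
Proof.
rewrite /x_at /y_at /z_at /xv /yv /zv !alpha_unwind beta_unwind (levelS a b n.+1).
have := pos_part_subN (a n.+1) (level a b n.+1).
by split; lra.
Qed.

Lemma unwindK : iota_path N (unwind l c) = c.
Proof.
apply: eq_path_seqs => n ltnN.
  have [_ yE _] := edge_unwind n.
  by rewrite -[LHS]/(a_ (iota_path N (unwind l c)) n%:Z) iota_aE yE.
have [xE _ zE] := edge_unwind n; have [_ yE _] := edge_unwind n.+1.
rewrite -[LHS]/(b_ l (iota_path N (unwind l c)) n.+1%:Z) iota_bE zE yE xE.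
exact: addrK.
Qed.

End Unwind.

Lemma level_nat a b n : b (- 1) \is a Num.nat ->
  (forall m : nat, a m%:Z \is a Num.nat) ->
  (forall m : nat, b m%:Z \is a Num.nat) -> level a b n \is a Num.nat.
Proof.
move=> b1 an bn; elim: n => [//|n IHn].
by rewrite levelS rpredD ?pos_part_natB.
Qed.

Lemma unwind_verlinde k l N (c : path_seqs N) : (l <= k)%N ->
  comb_paths k l N c -> verlinde_paths k l N (unwind l c).
Proof.
move=> lk /(comb_pathsP _ lk)[ra rb al lev0 c2].
set a := a_ c in al lev0 c2; set b := b_ l c in lev0 c2.
have an (n : nat) : a n \is a Num.nat by case: (in_range_nth n ra).
have bn (n : nat) : b n \is a Num.nat.
  by case: n => [|n]; rewrite ?rpred0 //; case: (in_range_nth n rb).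
have ln n : level a b n \is a Num.nat by apply: level_nat => //; exact: natr_nat.
have pn n := pos_part_natB (an n.+1) (ln n.+1).
have a0 n := natr_ge0 (an n); have b0 n := natr_ge0 (bn n).
have l0 n := natr_ge0 (ln n).
have pp0 n := natr_ge0 (pn n).
have sum_le n :
    level a b n.+1 + a n + (b n.+1 + pos_part (a n.+1 - level a b n.+1)) <= k%:R.
  have [] := c2 n; set u := pos_part _ => cA cB.
  suff : u <= k%:R - level a b n.+1 - a n - b n.+1 by lra.
  by rewrite /u pos_part_le; apply/andP; split; lra.
have alr n : in_range k (alpha (unwind l c) n.+1).
  rewrite alpha_unwind //; split; first by rewrite rpredD.
  by have := sum_le n; have := b0 n.+1; have := pp0 n; rewrite -/a -/b; lra.
have ber n : in_range k (beta (unwind l c) n.+1).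
  rewrite beta_unwind //; split; first by rewrite !rpredD.
  by have := sum_le n; have := l0 n.+1; rewrite -/a -/b; lra.
split.
- by move=> q /tnthP[i ->]; rewrite (tnth_nth 0); exact: alr.
- move=> q /tnthP[i ->]; rewrite (tnth_nth 0).
  by have := ber i; rewrite /beta ltn_eqF //; case: i => i /=; lia.
- rewrite alpha_unwind // levelS add0r pos_part_id /=; first by rewrite subrK.
  by rewrite subr_ge0.
- case=> // n _; split; first by split.
  have := sum_le n; have [] := edge_unwind lev0 n.
  rewrite /x_at /y_at /z_at -/a -/b => -> -> ->.
  by rewrite addrA; split=> //; exact: rpredD.
Qed.

Theorem theorem3p4p1 (k l N : nat) (hk : (1 <= k)%N) (hl : (l <= k)%N)
    (hN : (1 <= N)%N) :
  set_bij (verlinde_paths k l N) (comb_paths k l N) (iota_path N).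
Proof.
split; first by move=> p; exact: iota_comb.
- exact: iota_inj.
- move=> c cC; exists (unwind l c); first exact: unwind_verlinde.
  by apply: unwindK; case/(comb_pathsP _ hl): cC.
Qed.
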